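(* Let $X$ and $Y$ be two compact doubling metric spaces. Suppose $\mu$ and $\nu$ are box-counting measures of $X$ and $Y$, respectively. If $f:X\to Y$ is bi-Lipschitz (in particular a bijection), then $$f^*\mu\sim\nu .$$ Consequently, $\mu$ and $\nu$ have the same multi-fractal spectrum, and $\mu$ is doubling if and only if $\nu$ is doubling.
   Context: Let $(X,d_X)$ be a compact metric space; $B(x,r)$ denotes the (open) ball in $X$ with center $x$ and radius $r$. For $A\subset X$ and $\delta>0$, a family of balls of $X$ of radius $\delta$ is a $\delta$-ball-packing of $A$ if the balls are pairwise disjoint and their centers lie in $A$. $\mathcal N_\delta(A)$ is the maximal cardinality of a $\delta$-ball-packing of $A$. The box dimension is $\dim_B X=\lim_{\delta\to0}\frac{\log \mathcal N_\delta(X)}{-\log\delta}$, when this limit exists. Compact Vitalli-type covering: a sequence $\mathcal F=\{\mathcal F_k\}_{k\ge1}$ where each $\mathcal F_k$ is a covering of $X$ by subsets of $X$, such that (i) every element of $\mathcal F_k$ is compact; (ii) there is an integer $\lambda$ such that for all $k\ge1$ every point $x\in X$ is covered by at most $\lambda$ elements of $\mathcal F_k$; (iii) $\max\{\operatorname{diam}A: A\in\mathcal F_k\}\to0$ as $k\to\infty$. Box-counting measure: suppose $\beta=\dim_B X$ exists, let $\mu$ be a finite Borel measure on $X$ and $\mathcal F$ a compact Vitalli-type covering of $X$. $\mu$ is an $\mathcal F$-box-counting measure if there is a constant $M>0$ such that for every $R\in\bigcup_{k\ge1}\mathcal F_k$ there is $\delta_0(R)>0$ with $$M^{-1}\mu(R)\le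 \mathcal N_\delta(R)\,\delta^{\beta}\le M\mu(R)\qquad\text{for all }0<\delta\le\delta_0(R).$$ $\mu$ is a box-counting measure of $X$ if it is an $\mathcal F$-box-counting measure for some compact Vitalli-type covering $\mathcal F$. A metric space $X$ is doubling if there is a constant $C>0$ such that for all $x\in X$, $r>0$, the ball $B(x,2r)$ can be covered by $C$ balls of radius $r$. A bijection $f:(X,d_X)\to(Y,d_Y)$ is bi-Lipschitz if there is $C>0$ with $C^{-1}d_X(x,y)\le d_Y(f(x),f(y))\le Cd_X(x,y)$ for all $x,y\in X$. $f^*\mu(A):=\mu(f^{-1}(A))$. Two Borel measures on the same space satisfy $\mu_1\sim\mu_2$ if there is $\zeta>0$ with $\zeta^{-1}\mu_1(A)\le\mu_2(A)\le\zeta\mu_1(A)$ for all Borel $A$. The multi-fractal spectrum of a finite Borel measure $\mu$ on $X$ is the function $\alpha\mapsto\dim_H\{x\in X:\lim_{r\to0}\frac{\log\mu(B(x,r))}{\log r}=\alpha\}$, $\alpha\ge0$. A finite Borel measure $\mu$ is doubling if there is $C>0$ with $0<\mu(B(x,2r))\le C\mu(B(x,r))$ for all $x\in X$, $r>0$.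
   Formalization: Each covering F_k is assumed finite, as ''max'' suggests; with infinite F_k the claim fails: for suitable shrinking plane segments accumulating at a point e, both length and length plus a point mass at e are box-counting measures, yet not equivalent. *)

(* Defs.v *)
From HB Require Import structures.
From mathcomp Require Import all_boot all_order all_algebra finmap.
From mathcomp Require Import all_classical all_reals all_analysis.

Set Implicit Arguments.
Unset Strict Implicit.
Unset Printing Implicit Defensive.

Import Order.TTheory GRing.Theory Num.Theory.
Import numFieldNormedType.Exports.

Local Open Scope classical_set_scope.
Local Open Scope ring_scope.

(* Nonempty metric spaces. The library only puts sigma-algebras on pointed
   types; [dim_B] is not defined on the empty space (log 0) anyway. *)
#[short(type="pointedMetricType")]
HB.structure Definition PointedMetric (K : numDomainType) :=
  { M of PseudoPointedMetric K M & Metric K M }.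

Section MetricSpace.
Context {R : realType} {X : metricType R}.
Implicit Types (A : set X) (d s : R).

(* The maximum with 0 only matters for the empty set, whose supremum of
   distances would be -oo. *)
Definition diam A : \bar R :=
  maxe 0%E (ereal_sup [set (mdist x y)%:E | x in A & y in A]).

(* Balls of radius d > 0 contain their center, so pairwise disjoint balls have
   distinct centers and a packing is determined by its set of centers. *)
Definition is_ball_packing d A (S : {fset X}) : Prop :=
  [set` S] `<=` A /\ trivIset [set` S] (fun x => ball x d).

(* In a compact space, these cardinalities are bounded for fixed d > 0, so that
   the supremum is a maximum. *)
Definition packing_number d A : R :=
  sup [set (#|` S|%:R : R) | S in is_ball_packing d A].

Definition doubling_space : Prop :=
  exists C : nat, (0 < C)%N /\
    forall (x : X) (r : R), 0 < r ->
      exists s : seq X, (size s <= C)%N /\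
        ball x (2 * r) `<=` \bigcup_(c in [set` s]) ball c r.

(* diam(A)^s, with diam(A)^0 = 1 for A nonempty *)
Definition hausdorff_gauge s A : \bar R :=
  if A == set0 then 0%E else poweR (diam A) s.

Definition hausdorff_content s d A : \bar R :=
  ereal_inf [set (\sum_(0 <= i <oo) hausdorff_gauge s (U i))%E |
    U in [set U : nat -> set X |
      A `<=` \bigcup_i U i /\ forall i, (diam (U i) <= d%:E)%E]].

(* The limit as d tends to 0, which is a supremum by monotonicity in d. *)
Definition hausdorff_measure s A : \bar R :=
  ereal_sup [set hausdorff_content s d A | d in [set d : R | 0 < d]].

Definition hausdorff_dim A : \bar R :=
  ereal_inf [set s%:E | s in [set s : R | 0 <= s /\ hausdorff_measure s A = 0%E]].

(* Indexed from 0 rather than 1. The finiteness of each covering F k is what the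
   "max" in the condition max {diam A : A in F_k} -> 0 stands for; two
   box-counting measures need not be equivalent if F k may be infinite. *)
Definition compact_vitalli_covering (F : nat -> set (set X)) : Prop :=
  [/\ forall k, finite_set (F k) /\ \bigcup_(A in F k) A = [set: X],
      forall k A, F k A -> compact A,
      exists lambda : nat, forall k x,
        ([set A | F k A /\ A x] #<= `I_lambda)%card
    & (ereal_sup [set diam A | A in F k]) @[k --> \oo] --> 0%E].

End MetricSpace.
Arguments doubling_space {R} X.

Section BoxDimension.
Context {R : realType}.
Variable X : metricType R.

Let box_ratio (d : R) : R := ln (packing_number d [set: X]) / - ln d.

Definition box_dim_exists : Prop := cvg (box_ratio d @[d --> 0^'+]).

Definition box_dim : R := lim (box_ratio d @[d --> 0^'+]).

End BoxDimension.

Definition bi_lipschitz {R : realType} {X Y : metricType R} (f : X -> Y) : Prop :=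
  bijective f /\
  exists C : R, 0 < C /\ forall x y : X,
    C^-1 * mdist x y <= mdist (f x) (f y) <= C * mdist x y.

(* X equipped with its Borel sigma-algebra *)
Notation borel X := (g_sigma_algebraType (@open X)).

Section BorelMeasures.
Context {R : realType} {X : pointedMetricType R}.
Local Open Scope ereal_scope.

Definition measure_equiv (mu1 mu2 : set (borel X) -> \bar R) : Prop :=
  exists zeta : R, (0 < zeta)%R /\ forall A : set (borel X), measurable A ->
    (zeta^-1)%:E * mu1 A <= mu2 A /\ mu2 A <= zeta%:E * mu1 A.

Implicit Types mu : {finite_measure set (borel X) -> \bar R}.

Definition box_counting_for (F : nat -> set (set X)) mu : Prop :=
  exists M : R, (0 < M)%R /\
    forall A : set X, (\bigcup_k F k) A ->
      exists d0 : R, (0 < d0)%R /\ forall d : R, (0 < d <= d0)%R ->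
        (M^-1)%:E * mu A <= (packing_number d A * d `^ box_dim X)%:E /\
        (packing_number d A * d `^ box_dim X)%:E <= M%:E * mu A.

Definition box_counting_measure mu : Prop :=
  box_dim_exists X /\
  exists F : nat -> set (set X),
    compact_vitalli_covering F /\ box_counting_for F mu.

Definition doubling_measure mu : Prop :=
  exists C : R, (0 < C)%R /\ forall (x : X) (r : R), (0 < r)%R ->
    0 < mu (ball x (2 * r)%R) /\ mu (ball x (2 * r)%R) <= C%:E * mu (ball x r).

(* The quotient is taken in \bar R: where mu (ball x r) = 0 and r < 1, it is
   -oo divided by a negative number, i.e. +oo. *)
Definition level_set mu (alpha : R) : set X :=
  [set x | (lne (mu (ball x r)) / (ln r)%:E) @[r --> (0:R)^'+] --> alpha%:E].

Definition multifractal_spectrum mu (alpha : R) : \bar R :=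
  hausdorff_dim (level_set mu alpha).

End BorelMeasures.

(* Main.v *)
Require Import Defs.
From mathcomp Require Import all_boot all_order all_algebra finmap.
From mathcomp Require Import all_classical all_reals all_analysis.
From mathcomp Require Import measurable_realfun ring lra.
Import Order.TTheory GRing.Theory Num.Theory.
Import numFieldNormedType.Exports.
Local Open Scope classical_set_scope.
Local Open Scope ring_scope.

Set Implicit Arguments.
Unset Strict Implicit.
Unset Printing Implicit Defensive.

(* For a set K and r > 0, cover K by the members of a fine covering F_k which
   meet K; they stay in the r-neighbourhood K_r of K. Bounded multiplicity,
   doubling and compactness make packing numbers additive up to constants over
   this finite family as delta -> 0, so that
     mu(K) <= c N_delta(K_r) delta^beta  and  N_delta(K) delta^beta <= c mu(K_r)
   for small delta. Packing numbers change only boundedly under bi-Lipschitz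
   maps, which gives mu(K) <= c nu(f(K)_r); letting r -> 0 settles closed K, and
   closed inner regularity of finite Borel measures settles Borel sets. The
   dimensions of X and Y agree because delta^beta N_delta(X) is bounded away from
   0 and infinity. *)

(** * Packings *)

Lemma count_le_sum (T : eqType) (U : Type) (s : seq T) (l : seq U) (P : pred T)
    (E : U -> pred T) :
  {in s, forall x, P x -> has (E^~ x) l} ->
  (count P s <= \sum_(c <- l) count (E c) s)%N.
Proof.
elim: s => [|x s IHs] PE //=.
rewrite big_split leq_add//=; last first.
  by apply: IHs => y ys; apply: PE; rewrite inE ys orbT.
case Px : (P x) => //=.
have /(_ Px) := PE x (mem_head _ _).
by rewrite has_count -sum1_count big_mkcond.
Qed.

Lemma sub_in_count (T : eqType) (s : seq T) (P Q : pred T) :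
  {in s, forall x, P x -> Q x} -> (count P s <= count Q s)%N.
Proof.
elim: s => //= x s IHs PQ; apply: leq_add.
  by case Px : (P x) => //; rewrite (PQ x)// mem_head.
by apply: IHs => y ys; apply: PQ; rewrite inE ys orbT.
Qed.

Lemma count_le1 (T : eqType) (s : seq T) (P : pred T) : uniq s ->
  {in s &, forall x y, P x -> P y -> x = y} -> (count P s <= 1)%N.
Proof.
move=> us Puniq; rewrite -size_filter.
case Es : [seq x <- s | P x] => [|x [|y t]] //.
have : uniq [seq x <- s | P x] by rewrite filter_uniq.
have [xs ys] : x \in [seq x <- s | P x] /\ y \in [seq x <- s | P x].
  by rewrite Es !inE !eqxx orbT.
move: xs ys; rewrite !mem_filter => /andP[Px xs] /andP[Py ys].
by rewrite Es /= (Puniq x y)// mem_head.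
Qed.

Lemma ball_mdist {R : realType} {X : metricType R} (x y : X) (r : R) :
  ball x r y = (mdist x y < r).
Proof. by rewrite ballEmdist. Qed.

Lemma open_mball {R : realType} {X : metricType R} (x : X) (r : R) :
  open (ball x r).
Proof.
rewrite openE => y; rewrite ball_mdist => xy.
apply/nbhs_ballP; exists (r - mdist x y) => /=; first by rewrite subr_gt0.
move=> z; rewrite !ball_mdist => yz.
by rewrite (le_lt_trans (metric_triangle x y z))// -ltrBrDl.
Qed.

Section Packings.
Context {R : realType} {X : pointedMetricType R}.
Implicit Types (A K : set X) (d r : R) (S T : {fset X}).

(** If [mdist x y < d], the point [y] lies in both balls, which disjointness forbids for distinct
    centers. So the centers of a packing are at mutual distance at least [d]; later arguments use a
    packing mostly through this separation. *)
Lemma packing_inj d A S : is_ball_packing d A S ->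
  {in S &, forall x y : X, mdist x y < d -> x = y}.
Proof.
move=> [_ /trivIsetP trS] x y xS yS xy; apply: contrapT => /eqP neq_xy.
have : (ball x d `&` ball y d) y.
  by split; rewrite ball_mdist// mdistxx (le_lt_trans _ xy)// mdist_ge0.
by rewrite (trS _ _ xS yS neq_xy).
Qed.

Lemma count_packing_ball_le1 d A S (x : X) :
  is_ball_packing d A S -> (count (fun y => `[< ball x (d / 2) y >]) S <= 1)%N.
Proof.
move=> pS; apply: count_le1 => [|y z yS zS /asboolP + /asboolP].
  exact: fset_uniq.
rewrite !ball_mdist => xy xz; apply: (packing_inj pS yS zS).
by rewrite (le_lt_trans (metric_triangle y x z))// metric_sym (splitr d) ltrD.
Qed.

(** Pigeonhole: two points of a ball of radius [d / 2] are closer than [d], so each such ball holds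
    at most one center. Every upper bound on a packing by a cover goes through this. *)
Lemma count_packing_le d A S (P : pred X) (l : seq X) :
  is_ball_packing d A S ->
  (forall x, P x -> exists2 c, c \in l & ball c (d / 2) x) ->
  (count P S <= size l)%N.
Proof.
move=> pS Pl.
apply: (@leq_trans (\sum_(c <- l) count (fun y => `[< ball c (d / 2) y >]) S)).
  apply: count_le_sum => x xS /Pl [c cl cx].
  by apply/hasP; exists c => //; exact/asboolP.
rewrite -sum1_size; apply: leq_sum => c _.
exact: count_packing_ball_le1 pS.
Qed.

Hypothesis X_compact : compact [set: X].

(** A finite cover of the whole space by balls of radius [d / 2] bounds all packings at once, hence
    a bound uniform in [A]. *)
Lemma packing_bounded d : 0 < d ->
  exists n, forall A S, is_ball_packing d A S -> (#|` S| <= n)%N.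
Proof.
move=> d0; move: X_compact; rewrite compact_cover => Xc.
have [||D _ cD] := Xc _ [set: X] (fun x => ball x (d / 2)).
- by move=> x _; exact: open_mball.
- by move=> x _; exists x => //; apply: ballxx; rewrite divr_gt0.
exists (size (enum_fset D)) => A S pS.
rewrite -[size S]count_predT; apply: (count_packing_le pS) => x _.
by have [c /= cD' cx] := cD x I; exists c.
Qed.

Lemma packing_has_ubound d A : 0 < d ->
  has_ubound [set (#|` S|%:R : R) | S in is_ball_packing d A].
Proof.
move=> /packing_bounded[n nP]; exists n%:R => _ [S pS <-].
by rewrite ler_nat; exact: nP pS.
Qed.

Lemma packing_number_ge d A S : 0 < d -> is_ball_packing d A S ->
  (#|` S|)%:R <= packing_number d A.
Proof.
by move=> d0 pS; apply: ub_le_sup; [exact: packing_has_ubound|exists S].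
Qed.

Lemma packing_number_max d A : 0 < d ->
  exists2 S, is_ball_packing d A S & packing_number d A = (#|` S|)%:R.
Proof.
move=> d0; have [n nP] := packing_bounded d0.
pose Q k := `[< exists2 S, is_ball_packing d A S & #|` S| = k >].
have Q0 : exists k, Q k.
  exists 0; apply/asboolP; exists fset0; last by rewrite cardfs0.
  by split => // x; rewrite /= inE.
have Qn k : Q k -> (k <= n)%N by move=> /asboolP[S /nP + <-].
case: (ex_maxnP Q0 Qn) => k /asboolP[S pS Sk] kmax.
exists S => //; apply/eqP; rewrite eq_le packing_number_ge// andbT.
apply: ge_sup; first by exists #|` S|%:R, S.
move=> _ [T pT <-]; rewrite ler_nat Sk; apply: kmax.
by apply/asboolP; exists T.
Qed.

Lemma packing_number_ge0 d A : 0 < d -> 0 <= packing_number d A.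
Proof. by move=> /(packing_number_max A)[S _ ->]. Qed.

Lemma packing_number_ge1 d A : 0 < d -> A !=set0 -> 1 <= packing_number d A.
Proof.
move=> d0 [x Ax].
rewrite -[1]/(1%:R) -(cardfs1 x); apply: packing_number_ge => //; split.
  by move=> y; rewrite /= inE => /eqP ->.
by apply/trivIsetP => y z; rewrite /= !inE => /eqP -> /eqP ->; rewrite eqxx.
Qed.

(** Lower bounds in terms of sequences, applied below to filtered packings, to a packing with one
    more point, and to images of packings. *)
Lemma packing_number_ge_seq d A (s : seq X) : 0 < d -> uniq s ->
  {in s, forall x, A x} ->
  {in s &, forall x y, ball x d `&` ball y d !=set0 -> x = y} ->
  (size s)%:R <= packing_number d A.
Proof.
move=> d0 us sA sd; rewrite -(undup_id us) -(size_seq_fset tt s).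
apply: packing_number_ge => //; split=> [x|].
  by rewrite mksetE seq_fsetE; exact: sA.
by move=> x y; rewrite !mksetE !seq_fsetE; exact: sd.
Qed.

(** The points of a maximal packing of [A] that lie in [B] form a packing of [B]. *)
Lemma packing_number_le_sum d A (l : seq (set X)) : 0 < d ->
  A `<=` \bigcup_(B in [set` l]) B ->
  packing_number d A <= \sum_(B <- l) packing_number d B.
Proof.
move=> d0 Al; have [S [SA Strv] ->] := packing_number_max A d0.
apply: (@le_trans _ _ (\sum_(B <- l) count (fun y => `[< B y >]) S)%:R).
  rewrite ler_nat -[size S]count_predT; apply: count_le_sum => x xS _.
  have [B /= Bl Bx] := Al _ (SA _ xS).
  by apply/hasP; exists B => //; exact/asboolP.
rewrite natr_sum; apply: ler_sum => B _; rewrite -size_filter.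
apply: packing_number_ge_seq => // [|x|x y]; rewrite ?filter_uniq ?fset_uniq//.
  by rewrite mem_filter => /andP[/asboolP].
by rewrite !mem_filter => /andP[_ xS] /andP[_ yS]; exact: Strv.
Qed.

End Packings.

(** * Packing numbers of finite closed families *)

Lemma near_right0P {R : realType} (P : R -> Prop) :
  (\forall d \near 0^'+, P d) <->
  exists2 e : R, 0 < e & forall d, 0 < d < e -> P d.
Proof.
split=> [|[e e0 eP]].
  move=> /nbhs_ballP[e /= e0 eP]; exists e => // d /andP[d0 de].
  by apply: eP => //; rewrite /ball/= sub0r normrN gtr0_norm.
near=> d; apply: eP; apply/andP; split; near: d.
  exact: nbhs_right_gt.
exact: nbhs_right_lt.
Unshelve. all: by end_near. Qed.

Lemma near_all_in {T : Type} {I : eqType} (F : set_system T) (l : seq I)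
    (P : I -> T -> Prop) : Filter F ->
  {in l, forall i, \forall t \near F, P i t} ->
  \forall t \near F, {in l, forall i, P i t}.
Proof.
move=> FF; elim: l => [|i l IHl] Pl; first by near=> t.
have Pi := Pl i (mem_head _ _).
have {}IHl : \forall t \near F, {in l, forall j, P j t}.
  by apply: IHl => j jl; apply: Pl; rewrite inE jl orbT.
near=> t => j; rewrite inE => /orP[/eqP ->|]; first by near: t.
by move: j; near: t.
Unshelve. all: by end_near. Qed.

Section PackingSums.
Context {R : realType} {X : pointedMetricType R}.
Hypothesis X_compact : compact [set: X].
Hypothesis X_doubling : doubling_space X.
Implicit Types (A K : set X) (d r : R).

(** A closed set missing [x] also misses a ball around [x]; hence small balls near [x] meet only
    those members of [l] that contain [x], at most [m] of them. Compactness makes the radius uniform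
    over the space. *)
Lemma multiplicity_near (l : seq (set X)) (m : nat) :
  {in l, forall A, closed A} ->
  (forall x, count (fun A => `[< A x >]) l <= m)%N ->
  \forall e \near (0 : R)^'+,
    forall p : X, (count (fun A => `[< A `&` ball p e !=set0 >]) l <= m)%N.
Proof.
move=> lcl lm; have /compact_near_coveringP Xcov := X_compact.
pose P (e : R) p := (count (fun A => `[< A `&` ball p e !=set0 >]) l <= m)%N.
suff : \forall e \near (0 : R)^'+, [set: X] `<=` P e.
  by apply: filterS => e eP p; exact: eP.
apply: Xcov => x _.
have : \forall e \near (0 : R)^'+,
    {in l, forall A, ~ A x -> A `&` ball x e = set0}.
  apply: near_all_in => A Al; have [Ax|nAx] := pselect (A x).
    by near=> e.
  have /nbhs_ballP[e /= e0 eA] : nbhs x (~` A).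
    by apply: open_nbhs_nbhs; split=> //; exact: closed_openC (lcl A Al).
  near=> d => _; rewrite -subset0 => y [Ay xdy].
  apply: (eA y) => //; apply: le_ball xdy; apply: ltW; near: d.
  exact: nbhs_right_lt.
move=> /near_right0P[e e0 eP].
(* For [p] within [e / 4] of [x] and [d < e / 4], the ball around [p] stays inside [ball x (e / 2)],
   and [e / 2] is a radius to which [eP] applies. *)
exists (ball x (e / 4), [set d | d < e / 4]) => /=.
  by split; [apply: nbhsx_ballx|apply: nbhs_right_lt]; rewrite divr_gt0.
move=> [p d] /= [xp de]; apply: leq_trans (lm x); apply: sub_in_count => A Al.
move=> /asboolP[y [Ay py]]; apply/asboolP; apply: contrapT => nAx.
have e2 : 0 < e / 2 < e by apply/andP; split; lra.
have : (A `&` ball x (e / 2)) y.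
  split=> //; move: xp py; rewrite !ball_mdist => xp py.
  by have := metric_triangle x p y; lra.
by rewrite (eP _ e2 A Al nAx).
Unshelve. all: by end_near. Qed.

(** Doubling is used twice, from [2 * d] to [d] and from [d] to [d / 2], whence [C * C]. The radius
    [d / 2] is the one at which a ball holds at most one point of a packing. *)
Lemma doubling_half_cover : exists D, forall (x : X) d, 0 < d ->
  exists2 s : seq X, (size s <= D)%N &
    forall y, ball x (2 * d) y -> exists2 c, c \in s & ball c (d / 2) y.
Proof.
have [C [_ CP]] := X_doubling; exists (C * C)%N => x d d0.
have [s [sC sP]] := CP x d d0.
have d20 : 0 < d / 2 by rewrite divr_gt0.
have [t tP] := choice (fun c => CP c _ d20).
exists (flatten [seq t c | c <- s]) => [|y /sP[c /= cs]].
  rewrite size_flatten /shape -map_comp.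
  apply: (@leq_trans (\sum_(c <- s) C)); last first.
    by rewrite big_const_seq count_predT iter_addn_0 mulnC leq_mul2r sC orbT.
  rewrite sumnE big_map; apply: leq_sum => c _; exact: (tP c).1.
have := (tP c).2 y; rewrite mulrCA divff// mulr1 => /[apply] -[e /= et ey].
by exists e => //; apply/flatten_mapP; exists c.
Qed.

(* Every point of a packing of some [B] is within [2 * d] of a maximal packing of
   [A]; each point of the latter is that close to at most [m] of the [B]s, and to
   at most [D] points of the packing of each. *)
Lemma sum_packing_number_le : exists D : nat, forall A (l : seq (set X)) m,
  {in l, forall B, closed B} -> {in l, forall B, B `<=` A} ->
  (forall x, count (fun B => `[< B x >]) l <= m)%N ->
  \forall d \near 0^'+,
    \sum_(B <- l) packing_number d B <= (m * D)%:R * packing_number d A.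
Proof.
have [D DP] := doubling_half_cover; exists D => A l m lcl lA lm.
have /near_right0P[e e0 eP] := multiplicity_near lcl lm.
apply/near_right0P; exists (e / 2) => [|d /andP[d0 de]]; first lra.
have {eP}mult (p : X) :
    (count (fun B => `[< B `&` ball p (2 * d) !=set0 >]) l <= m)%N.
  by apply: eP; apply/andP; split; lra.
have [T pT NT] := packing_number_max X_compact A d0.
have /choice[S SP] : forall B : set X, exists S : {fset X},
    is_ball_packing d B S /\ packing_number d B = (#|` S|)%:R.
  by move=> B; have [S] := packing_number_max X_compact B d0; exists S.
under eq_bigr do rewrite (SP _).2.
rewrite NT -natr_sum -natrM ler_nat.
have SBT B : B \in l -> (#|` S B| <=
    \sum_(t <- T) count (fun y => `[< ball t (2 * d) y >]) (S B))%N.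
  move=> Bl; rewrite -[size (S B)]count_predT; apply: count_le_sum => x xS _.
  (* Otherwise [x] could be added to the maximal packing [T]. *)
  apply: contrapT => /negP/hasPn Tx.
  have xT t : t \in T -> ball t d `&` ball x d = set0.
    move=> tT; rewrite -subset0 => y [ty xy]; move/asboolP: (Tx t tT); apply.
    move: ty xy; rewrite !ball_mdist => ty xy.
    by have := metric_triangle t y x; rewrite (metric_sym y x); lra.
  have xNT : x \notin T.
    apply/negP => xT'; have : (ball x d `&` ball x d) x by split; exact: ballxx.
    by rewrite xT.
  have := @packing_number_ge_seq _ _ X_compact d A (x :: T) d0.
  rewrite NT ler_nat /= xNT fset_uniq ltnn => /(_ isT) H.
  suff : false by []. apply: H => [y|y z].
    by rewrite inE => /predU1P[->|/pT.1//]; apply: (lA B Bl); exact: (SP B).1.1.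
  rewrite !inE => /predU1P[->|yT] /predU1P[->|zT] //.
  - by rewrite setIC xT// => -[].
  - by rewrite xT// => -[].
  - by move=> yz; apply: pT.2 yz.
apply: (@leq_trans (\sum_(B <- l) \sum_(t <- T)
    count (fun y => `[< ball t (2 * d) y >]) (S B))).
  by rewrite big_seq [leqRHS]big_seq; exact: leq_sum.
rewrite exchange_big/= mulnC -sum1_size big_distrl/=.
apply: leq_sum => t _; rewrite mul1n.
apply: (@leq_trans (\sum_(B <- l | `[< B `&` ball t (2 * d) !=set0 >]) D)).
  rewrite [leqRHS]big_mkcond/= leq_sum// => B _; case: asboolP => [_|nBt].
    have [s sD sP] := DP t d d0; apply: leq_trans sD.
    by apply: (count_packing_le (SP B).1) => y /asboolP; exact: sP.
  rewrite leqn0 eqn0Ngt -has_count; apply/hasPn => y yS; apply/asboolP => ty.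
  by apply: nBt; exists y; split=> //; exact: (SP B).1.1.
by rewrite big_const_seq iter_addn_0 mulnC leq_mul2r mult orbT.
Qed.

End PackingSums.

(** * Borel measures and multiplicity *)

Section BorelSets.
Context {R : realType} {X : pointedMetricType R}.
Implicit Types (A B K V : set X) (r : R).

Lemma borel_open A : open A -> measurable (A : set (borel X)).
Proof. by move=> oA; exact: sub_sigma_algebra. Qed.

Lemma borel_closed A : closed A -> measurable (A : set (borel X)).
Proof.
move=> clA; rewrite -(setCK A); apply: measurableC; apply: borel_open.
exact: closed_openC.
Qed.

Definition thickening K r : set X := \bigcup_(x in K) ball x r.

Lemma open_thickening K r : open (thickening K r).
Proof. by apply: bigcup_open => x _; exact: open_mball. Qed.

Lemma sub_thickening K r : 0 < r -> K `<=` thickening K r.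
Proof. by move=> r0 x Kx; exists x => //; exact: ballxx. Qed.

Variable mu : {finite_measure set (borel X) -> \bar R}.
Local Open Scope ereal_scope.

Lemma le_measure_sum_seq K (l : seq (set X)) :
  measurable (K : set (borel X)) ->
  {in l, forall B, measurable (B : set (borel X))} ->
  K `<=` \bigcup_(B in [set` l]) B -> mu K <= \sum_(B <- l) mu B.
Proof.
elim: l K => [|B l IHl] K mK ml Kl.
  rewrite big_nil (_ : K = set0) ?measure0// -subset0 => x /Kl[B].
  by rewrite /= in_nil.
have mB : measurable (B : set (borel X)) by apply: ml; exact: mem_head.
rewrite big_cons (@le_trans _ _ (mu (B `|` (K `\` B))))//.
  apply: le_measure; rewrite ?inE//.
    by apply: measurableU => //; exact: measurableD.
  by move=> x Kx; have [Bx|nBx] := pselect (B x); [left|right].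
rewrite (le_trans (measureU2 _ mB _))//; first exact: measurableD.
rewrite leeD2l// IHl//; first exact: measurableD.
  by move=> C Cl; apply: ml; rewrite inE Cl orbT.
by move=> x [/Kl[C /= + Cx] nBx]; rewrite inE => /predU1P[CB|Cl];
  [rewrite CB in Cx|exists C].
Qed.

(** Integrate over [V] the sum of the indicators of the members of [l], which is at most [m] at each
    point. *)
Lemma sum_measure_le_multiplicity (l : seq (set X)) (m : nat) V :
  {in l, forall B, measurable (B : set (borel X))} ->
  {in l, forall B, B `<=` V} -> measurable (V : set (borel X)) ->
  (forall x, count (fun B => `[< B x >]) l <= m)%N ->
  \sum_(B <- l) mu B <= m%:R%:E * mu V.
Proof.
move=> ml lV mV lm.
(* [h] agrees with the identity on [l] and is measurable for every index, as exchanging sum and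
   integral requires. *)
pose h (B : set X) : set (borel X) := if B \in l then B else set0.
have mh B : measurable (h B) by rewrite /h; case: ifPn => [/ml|].
have -> : \sum_(B <- l) mu B = \sum_(B <- l) \int[mu]_(x in V) (\1_(h B) x)%:E.
  rewrite big_seq [RHS]big_seq; apply: eq_bigr => B Bl.
  rewrite integral_indic// /h Bl setIidl//; exact: lV.
have mindic B :
    measurable_fun (V : set (borel X)) (fun x => (\1_(h B) x)%:E : \bar R).
  by apply/measurable_EFinP; exact: measurable_indic.
rewrite -ge0_integral_sum//=.
have <- := integral_cst mu mV m%:R%:E; apply: ge0_le_integral => //=.
- by move=> x _; apply: sume_ge0 => B _; rewrite lee_fin.
- exact: emeasurable_sum.
move=> x _; rewrite sumEFin lee_fin.
under eq_bigr do rewrite indicE.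
rewrite -natr_sum ler_nat; apply: leq_trans (lm x).
rewrite -sum1_count [leqRHS]big_mkcond/=; apply: leq_sum => B _.
rewrite /h; case: ifPn => _; last by rewrite in_set0.
by rewrite /in_mem /= /in_set; case: ifP.
Qed.

End BorelSets.

(** * Box-counting estimates *)

Lemma mdist_le_diam {R : realType} {X : metricType R} (A : set X) (x y : X) :
  A x -> A y -> ((mdist x y)%:E <= diam A)%E.
Proof.
move=> Ax Ay; rewrite /diam le_max; apply/orP; right.
by apply: ereal_sup_ubound; exists x => //; exists y.
Qed.

Section Estimates.
Context {R : realType} {X : pointedMetricType R}.
Implicit Types (A B K V : set X) (d r : R).

(** Choose [k] with all diameters in [F k] below [r] and keep the members that meet [K]. The bound
    [m] is the multiplicity of the covering, fixed before [K] and [r], so that the constants derived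
    from it depend on neither. *)
Lemma vitalli_subfamily (F : nat -> set (set X)) :
  compact_vitalli_covering F -> exists m : nat, forall K r, 0 < r ->
  exists l : seq (set X), [/\ {in l, forall B, (\bigcup_k F k) B /\ closed B},
    {in l, forall B, B `<=` thickening K r}, K `<=` \bigcup_(B in [set` l]) B
    & forall x, (count (fun B => `[< B x >]) l <= m)%N].
Proof.
move=> [Fcov Fcpt [m Fm] Fdiam]; exists m => K r r0.
have [k] : exists k, (ereal_sup [set diam A | A in F k] < r%:E)%E.
  apply: (@filter_ex _ \oo); apply: (Fdiam [set x | (x < r%:E)%E]).
  exact: (@nbhs_open_ereal_lt _ 0 (fun=> r)).
move=> Fr; have [finF covF] := Fcov k.
pose l := [seq B <- fset_set (F k) | `[< B `&` K !=set0 >]].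
have lF B : B \in l -> F k B /\ B `&` K !=set0.
  by rewrite mem_filter in_fset_set// => /andP[/asboolP BK /set_mem].
exists l; split => [B /lF[FB _]|B /lF[FB [x [Bx Kx]]] y By|x Kx|x].
- by split; [exists k|apply: compact_closed (Fcpt _ _ FB); exact: metric_hausdorff].
- exists x => //; rewrite ball_mdist -lte_fin (le_lt_trans _ Fr)//.
  by rewrite (le_trans (mdist_le_diam Bx By))// ereal_sup_ubound//; exists B.
- have : [set: X] x by [].
  rewrite -covF => -[B FB Bx]; exists B => //=.
  by rewrite mem_filter in_fset_set// mem_set// andbT; apply/asboolP; exists x.
apply: leq_trans (geq_card_fset_set (Fm k x)).
rewrite -size_filter; apply: uniq_leq_size.
  by rewrite !filter_uniq ?fset_uniq.
move=> B; rewrite mem_filter => /andP[/asboolP Bx /lF[FB _]].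
rewrite in_fset_set; first exact: mem_set.
by apply: sub_finite_set finF => A [].
Qed.

Variable mu : {finite_measure set (borel X) -> \bar R}.
Hypothesis X_compact : compact [set: X].
Hypothesis mu_box : box_counting_measure mu.
Local Open Scope ereal_scope.

Let beta := box_dim X.

(** With the subfamily [l] of [K] and [r], the packing number of [K] is at most the sum of those of
    the members; each is controlled by [M] times its measure, and the measures add up to at most [m]
    times that of the thickening. Only the threshold on [d] depends on [K] and [r]. *)
Lemma packing_le_measure : exists2 c : R, (0 < c)%R & forall K r, (0 < r)%R ->
  \forall d \near 0^'+,
    (packing_number d K * d `^ beta)%:E <= c%:E * mu (thickening K r).
Proof.
have [_ [F [Fcov [M [M0 MP]]]]] := mu_box.
(* The successor keeps the constant positive even if [m] is 0. *)
have [m mP] := vitalli_subfamily Fcov; exists (M * m.+1%:R)%R.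
  by rewrite mulr_gt0.
move=> K r r0; have [l [lF lr Kl lm]] := mP K r r0.
have mr : measurable (thickening K r : set (borel X)).
  by apply: borel_open; exact: open_thickening.
have : \forall d \near 0^'+, {in l, forall B,
    (packing_number d B * d `^ beta)%:E <= M%:E * mu B}.
  apply: near_all_in => B /lF[FB _]; apply/near_right0P.
  have [d0 [d00 dP]] := MP B FB.
  by exists d0 => // d /andP[e0 ed]; apply: (dP d _).2; rewrite e0 ltW.
have : \forall d \near (0 : R)^'+, (0 < d)%R by exact: nbhs_right_gt.
apply: filterS2 => d d0 dP.
apply: (@le_trans _ _ (\sum_(B <- l) (packing_number d B * d `^ beta)%:E)).
  rewrite sumEFin lee_fin -mulr_suml ler_wpM2r ?powR_ge0//.
  exact: packing_number_le_sum.
apply: (@le_trans _ _ (\sum_(B <- l) (M%:E * mu B))).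
  by rewrite big_seq [leRHS]big_seq; apply: lee_sum.
rewrite -ge0_sume_distrr; last by move=> B _; exact: measure_ge0.
rewrite EFinM -muleA lee_pmul2l ?lte_fin//.
apply: sum_measure_le_multiplicity => // [B /lF[_ +]|x]; first exact: borel_closed.
exact/ltnW/lm.
Qed.

Hypothesis X_doubling : doubling_space X.

(** The converse chain: subadditivity of [mu] over the subfamily, the lower box-counting bound on
    each member, then [sum_packing_number_le], since all members lie in the thickening. *)
Lemma measure_le_packing : exists2 c : R, (0 < c)%R & forall K r, (0 < r)%R ->
  measurable (K : set (borel X)) -> \forall d \near 0^'+,
    mu K <= (c * (packing_number d (thickening K r) * d `^ beta))%:E.
Proof.
have [_ [F [Fcov [M [M0 MP]]]]] := mu_box.
have [m mP] := vitalli_subfamily Fcov.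
have [D DP] := sum_packing_number_le X_compact X_doubling.
exists (M * (m * D).+1%:R)%R; first by rewrite mulr_gt0.
move=> K r r0 mK; have [l [lF lr Kl lm]] := mP K r r0.
have : \forall d \near 0^'+, {in l, forall B,
    mu B <= (M * (packing_number d B * d `^ beta))%:E}.
  apply: near_all_in => B /lF[FB _]; apply/near_right0P.
  have [d0 [d00 dP]] := MP B FB.
  exists d0 => // d /andP[e0 ed]; rewrite EFinM -lee_pdivrMl//.
  by apply: (dP d _).1; rewrite e0 ltW.
have : \forall d \near 0^'+, (\sum_(B <- l) packing_number d B <=
    (m * D)%:R * packing_number d (thickening K r))%R.
  by apply: DP => // B /lF[].
have : \forall d \near (0 : R)^'+, (0 < d)%R by exact: nbhs_right_gt.
apply: filterS3 => d d0 sumd dP.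
apply: (@le_trans _ _ (\sum_(B <- l) mu B)).
  by apply: le_measure_sum_seq => // B /lF[_]; exact: borel_closed.
apply: (@le_trans _ _ (\sum_(B <- l) (M * (packing_number d B * d `^ beta))%:E)).
  by rewrite big_seq [leRHS]big_seq; apply: lee_sum.
rewrite sumEFin lee_fin -mulr_sumr -mulr_suml -mulrA ler_pM2l// mulrA.
rewrite ler_wpM2r ?powR_ge0// (le_trans sumd)// ler_wpM2r ?packing_number_ge0//.
by rewrite ler_nat.
Qed.

(** Some member [B] of a fine covering satisfies [x] in [B] and lies in the ball; its packing
    numbers are at least 1, so the upper box-counting bound forces its measure to be positive. *)
Lemma box_counting_gt0 (x : X) r : (0 < r)%R -> 0 < mu (ball x r).
Proof.
move=> r0; have [_ [F [Fcov [M [M0 MP]]]]] := mu_box.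
have [m mP] := vitalli_subfamily Fcov.
have [l [lF lr xl _]] := mP [set x] r r0.
have [B /= Bl Bx] := xl x erefl; have [FB clB] := lF B Bl.
have [d [d0 dP]] := MP B FB.
apply: (@lt_le_trans _ _ (mu B)).
  have dd : (0 < d <= d)%R by rewrite d0 lexx.
  have := (dP d dd).2; apply: contraTT; rewrite -!leNgt -ltNge => muB.
  apply: (@le_lt_trans _ _ 0); first by rewrite pmule_rle0 ?lte_fin.
  rewrite lte_fin mulr_gt0 ?powR_gt0// (lt_le_trans ltr01)//.
  by apply: packing_number_ge1 => //; exists x.
apply: le_measure; rewrite ?inE; first exact: borel_closed.
  by apply: borel_open; exact: open_mball.
by move=> y /(lr B Bl)[z -> ].
Qed.

End Estimates.

(** * Closed regularity of finite Borel measures *)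

Section Regularity.
Context {R : realType} {X : pointedMetricType R}.
Variable mu : {finite_measure set (borel X) -> \bar R}.
Implicit Types (A B C K U : set (borel X)) (e : R).
Local Open Scope ereal_scope.

Lemma nonincreasing_measure_lt (F : nat -> set (borel X)) (e : \bar R) :
  (forall n, measurable (F n)) ->
  (forall n m, (n <= m)%N -> F m `<=` F n) ->
  mu (\bigcap_n F n) < e -> exists n, mu (F n) < e.
Proof.
move=> mF Fdec Fe.
have : mu (F n) @[n --> \oo] --> mu (\bigcap_n F n).
  apply: nonincreasing_cvg_mu => //.
  - by rewrite -ge0_fin_numE//; exact: fin_num_measure.
  - exact: bigcapT_measurable.
  - by move=> n m nm; apply/subsetPset; exact: Fdec.
move=> /(_ [set x | x < e]) Fcvg.
have [|n _ /(_ n (leqnn n))] := Fcvg; last by exists n.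
by apply: open_nbhs_nbhs; split=> //; exact: open_ereal_lt_ereal.
Qed.

Lemma bigcap_thickening (C : set X) :
  closed C -> \bigcap_n thickening C n.+1%:R^-1 = C.
Proof.
move=> clC; apply/seteqP; split=> [x Cx|x Cx n _]; last exact: sub_thickening.
apply: clC => V /nbhs_ballP[e /= e0 eV].
have [n _ /(_ n (leqnn n)) /= ne] := near_infty_natSinv_lt (PosNum e0).
have [y Cy yx] := Cx n I; exists y; split=> //; apply: eV.
by apply/ball_sym; apply: le_ball yx; exact: ltW.
Qed.

(** Continuity from above: the thickenings of radius 1/(n+1) decrease to the closed set itself, and
    the measure is finite. *)
Lemma thickening_measure_lt (C : set X) (e : \bar R) : closed C -> mu C < e ->
  exists2 r : R, (0 < r)%R & mu (thickening C r) < e.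
Proof.
move=> clC Ce; pose F n : set (borel X) := thickening C n.+1%:R^-1.
have [n ?] : exists n, mu (F n) < e; last by exists n.+1%:R^-1%R.
apply: nonincreasing_measure_lt.
- by move=> n; apply: borel_open; exact: open_thickening.
- move=> n m nm x [y Cy yx]; exists y => //; apply: le_ball yx.
  by rewrite lef_pV2 ?posrE// ler_nat ltnS.
- by rewrite bigcap_thickening.
Qed.

(** Inner and outer approximation are required together: this makes the condition symmetric under
    complements, so that the sets satisfying it form a sigma-algebra. *)
Let regular : set (set (borel X)) := [set B | forall e, (0 < e)%R ->
  exists K U : set X, [/\ closed K, open U, K `<=` B, B `<=` U &
    mu (U `\` K) < e%:E]].

Lemma regular_closed (C : set X) : closed C -> regular C.
Proof.
move=> clC e e0; have mC := borel_closed clC.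
have [|r r0 Cr] := @thickening_measure_lt C (mu C + e%:E) clC.
  by rewrite lteDl ?fin_num_measure// lte_fin.
exists C, (thickening C r); split => //; first exact: open_thickening.
  exact: sub_thickening.
have mCr : measurable (thickening C r : set (borel X)).
  by apply: borel_open; exact: open_thickening.
rewrite measureD//; last by rewrite -ge0_fin_numE//; exact: fin_num_measure.
rewrite setIidr ?lteBlDl ?fin_num_measure//; exact: sub_thickening.
Qed.

Lemma regularC B : regular B -> regular (~` B).
Proof.
move=> rB e /rB[K [U [clK oU KB BU UK]]]; exists (~` U), (~` K); split.
- exact: open_closedC.
- exact: closed_openC.
- exact: subsetC.
- exact: subsetC.
- by rewrite setDE setCK setIC -setDE.
Qed.

(** The union of all the closed sets [K n] need not be closed, so it is cut off at a finite stage;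
    continuity from above keeps the error below [e]. *)
Lemma regular_bigcup (B : nat -> set (borel X)) :
  (forall n, regular (B n)) -> regular (\bigcup_n B n).
Proof.
(* These errors sum to [e / 2], which leaves the strict inequality needed for the cut-off. *)
move=> rB e e0; have en n : (0 < e / 2 / (2 ^ n.+1)%:R)%R.
  by rewrite !divr_gt0// ltr0n expn_gt0.
have [K KP] := choice (fun n => rB n _ (en n)).
have [U UP] := choice KP.
pose V : set (borel X) := \bigcup_n U n.
pose F n : set (borel X) := V `\` \bigcup_(i in `I_n) K i.
have mK n : measurable (K n : set (borel X)).
  by apply: borel_closed; case: (UP n).
have mU n : measurable (U n : set (borel X)) by apply: borel_open; case: (UP n).
have [n Fn] : exists n, mu (F n) < e%:E.
  apply: nonincreasing_measure_lt => [n|n m nm x [Vx nKx]|].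
  - by apply: measurableD; [|apply: bigcup_measurable => k _]; first exact: bigcupT_measurable.
  - split=> //; apply: contra_not nKx => -[i /= ni Kx].
    by exists i => //=; exact: leq_trans nm.
  apply: (@le_lt_trans _ _ (\sum_(0 <= n <oo) (0 + (e / 2 / (2 ^ n.+1)%:R)%:E))).
    apply: (@le_trans _ _ (\sum_(0 <= n <oo) mu (U n `\` K n))).
      apply: measure_sigma_subadditive.
      - by move=> n; exact: measurableD.
      - by apply: bigcapT_measurable => n; apply: measurableD;
          [|apply: bigcup_measurable => k _]; first exact: bigcupT_measurable.
      move=> x Fx; have [[n _ Ux] _] := Fx 0%N I; exists n => //; split=> // Kx.
      (* [F n.+1] is the first of these sets from which [K n] is removed. *)
      by have [_] := Fx n.+1 I; apply; exists n => //=.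
    apply: lee_nneseries => // n _; rewrite add0e; apply: ltW.
    by case: (UP n).
  apply: le_lt_trans (epsilon_trick _ _ _) _ => //; first by rewrite divr_ge0// ltW.
  rewrite eseries0// add0e lte_fin; lra.
exists (\bigcup_(i in `I_n) K i), V; split=> //.
- by apply: closed_bigcup => // i _; case: (UP i).
- by apply: bigcup_open => i _; case: (UP i).
- by move=> x [i _ Kx]; exists i => //; case: (UP i) => _ _ /(_ x Kx).
- by apply: subset_bigcup => i _; case: (UP i).
Qed.

Lemma borel_regular B : measurable B -> forall e, (0 < e)%R ->
  exists K U : set X, [/\ closed K, open U, K `<=` B, B `<=` U &
    mu (U `\` K) < e%:E].
Proof.
suff : measurable `<=` regular by apply.
apply: smallest_sub; last first.
  move=> A oA; rewrite -(setCK A); apply: regularC; apply: regular_closed.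
  exact: open_closedC.
split; [apply: regular_closed; exact: closed0|move=> A|exact: regular_bigcup].
by rewrite setTD; exact: regularC.
Qed.

End Regularity.

(** * Comparison of measures under a bi-Lipschitz map *)

Lemma near_scale {R : realType} (P : R -> Prop) (k : R) : 0 < k ->
  (\forall d \near 0^'+, P d) -> \forall d \near 0^'+, P (d / k).
Proof.
move=> k0 /near_right0P[e e0 eP]; apply/near_right0P; exists (e * k).
  by rewrite mulr_gt0.
by move=> d /andP[d0 de]; apply: eP; rewrite divr_gt0//= ltr_pdivrMr.
Qed.

Lemma near_powR_lt {R : realType} (p e : R) : 0 < p -> 0 < e ->
  \forall d \near 0^'+, d `^ p < e.
Proof.
move=> p0 e0; apply/near_right0P; exists (e `^ p^-1); first exact: powR_gt0.
move=> d /andP[d0 de].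
have -> : e = (e `^ p^-1) `^ p by rewrite -powRrM mulVf ?gt_eqF// powRr1// ltW.
by apply: gt0_ltr_powR => //; rewrite nnegrE ltW// powR_gt0.
Qed.

(** * Growth of the packing numbers of the whole space *)

Section PackingBounds.
Context {R : realType} {X : pointedMetricType R}.
Hypothesis X_compact : compact [set: X].
Variable mu : {finite_measure set (borel X) -> \bar R}.
Hypothesis mu_box : box_counting_measure mu.

Lemma packing_number_subset d (A B : set X) : 0 < d -> A `<=` B ->
  packing_number d A <= packing_number d B.
Proof.
move=> d0 AB; rewrite (le_trans (packing_number_le_sum X_compact (l := [:: B]) d0 _))//.
  by move=> x Ax; exists B; [exact: mem_head|exact: AB].
by rewrite big_seq1.
Qed.

(** The whole space is its own thickening, so the estimates for [K] apply to it without loss. They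
    are sharper than the logarithmic limit defining [box_dim], and allow the dimensions of two
    spaces to be compared. *)
Lemma packing_number_le_powR : exists2 c : R, 0 < c &
  \forall d \near 0^'+, packing_number d [set: X] * d `^ box_dim X <= c.
Proof.
have [c c0 cP] := packing_le_measure X_compact mu_box.
exists (c * (fine (mu setT) + 1)).
  by rewrite mulr_gt0// ltr_wpDl// fine_ge0.
apply: filterS (cP setT 1 ltr01) => d.
have -> : thickening [set: X] 1 = setT.
  by apply/seteqP; split=> // x _; exact: sub_thickening.
rewrite -[X in (_ <= _ * X)%E]fineK ?fin_num_measure// -EFinM lee_fin.
by move=> /le_trans; apply; rewrite ler_pM2l// lerDl.
Qed.

Hypothesis X_doubling : doubling_space X.

Lemma packing_number_ge_powR : exists2 c : R, 0 < c &
  \forall d \near 0^'+, c <= packing_number d [set: X] * d `^ box_dim X.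
Proof.
have [c c0 cP] := measure_le_packing X_compact mu_box X_doubling.
exists (c^-1 * fine (mu setT)).
  rewrite mulr_gt0 ?invr_gt0// fine_gt0// -ge0_fin_numE// fin_num_measure// andbT.
  apply: (@lt_le_trans _ _ (mu (ball (point : X) 1))).
    exact: box_counting_gt0.
  by apply: le_measure; rewrite ?inE//; apply: borel_open; exact: open_mball.
apply: filterS (cP setT 1 ltr01 measurableT) => d.
have -> : thickening [set: X] 1 = setT.
  by apply/seteqP; split=> // x _; exact: sub_thickening.
by rewrite -[X in (X <= _)%E]fineK ?fin_num_measure// lee_fin ler_pdivrMl.
Qed.

End PackingBounds.

Section BiLipschitz.
Context {R : realType} {X Y : pointedMetricType R}.
Hypothesis X_compact : compact [set: X].
Hypothesis Y_compact : compact [set: Y].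
Variables (f : X -> Y) (g : Y -> X) (L : R).
Hypothesis L0 : 0 < L.
Hypotheses (fK : cancel f g) (gK : cancel g f).
Hypothesis f_lip : forall x x', mdist (f x) (f x') <= L * mdist x x'.
Hypothesis g_lip : forall y y', mdist (g y) (g y') <= L * mdist y y'.

(** If the balls of radius [d / (2 * L)] at [f x] and [f x'] share a point, then [f x] and [f x']
    are closer than [d / L], so [x] and [x'] are closer than [d] and coincide. The factor 2 pays for
    the passage through the common point. *)
Lemma packing_number_image d (A : set X) : 0 < d ->
  packing_number d A <= packing_number (d / (2 * L)) (f @` A).
Proof.
move=> d0; have [S pS ->] := packing_number_max X_compact A d0.
rewrite -(size_map f); apply: packing_number_ge_seq => //.
- by rewrite divr_gt0// mulr_gt0.
- by rewrite map_inj_uniq ?fset_uniq//; exact: can_inj fK.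
- by move=> _ /mapP[x xS ->]; exists x => //; exact: pS.1.
move=> _ _ /mapP[x xS ->] /mapP[x' xS' ->] [z []].
rewrite !ball_mdist => xz xz'; congr f; apply: (packing_inj pS) => //.
rewrite -(fK x) -(fK x'); apply: (le_lt_trans (g_lip _ _)).
rewrite -ltr_pdivlMl//; apply: (le_lt_trans (metric_triangle _ z _)).
rewrite (metric_sym z); apply: (lt_le_trans (ltrD xz xz')).
have -> : d / (2 * L) = L^-1 * d / 2 by field; rewrite gt_eqF.
by rewrite -splitr.
Qed.

Lemma thickening_image (K : set X) r :
  f @` thickening K r `<=` thickening (f @` K) (L * r).
Proof.
move=> _ [x [k Kk kx] <-]; exists (f k); first by exists k.
by move: kx; rewrite !ball_mdist => kx; rewrite (le_lt_trans (f_lip _ _))// ltr_pM2l.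
Qed.

Lemma thickeningD (K : set Y) r s :
  thickening (thickening K r) s `<=` thickening K (r + s).
Proof.
by move=> y [z [k Kk kz] zy]; exists k => //; exact: ball_triangle kz zy.
Qed.

(** Images under [f] become preimages under the Lipschitz map [g], which preserve open, closed and
    Borel sets. *)
Lemma image_preimage_inverse (A : set X) : f @` A = g @^-1` A.
Proof.
apply/seteqP; split=> [_ [x Ax <-]|y Agy]; first by rewrite /preimage/= fK.
by exists (g y).
Qed.

Lemma open_image (A : set X) : open A -> open (f @` A).
Proof.
rewrite image_preimage_inverse !openE => oA y /oA /nbhs_ballP[e /= e0 eA].
apply/nbhs_ballP; exists (e / L) => /=; first by rewrite divr_gt0.
move=> z yz; apply: eA; move: yz; rewrite !ball_mdist ltr_pdivlMr// mulrC.
exact: le_lt_trans.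
Qed.

Lemma closed_image (A : set X) : closed A -> closed (f @` A).
Proof.
move=> /closed_openC/open_image; rewrite !image_preimage_inverse => oA.
by rewrite -[X in closed X]setCK; apply: open_closedC.
Qed.

Lemma borel_image (A : set X) : measurable (A : set (borel X)) ->
  measurable (f @` A : set (borel Y)).
Proof.
rewrite image_preimage_inverse => mA.
have mg : measurable_fun setT (g : borel Y -> borel X).
  apply: (@measurability _ _ (borel Y) (borel X) setT g (@open X)) => // _ [U oU <-].
  rewrite setTI -image_preimage_inverse; apply: borel_open; exact: open_image.
by rewrite -[X in measurable X]setTI; exact: mg.
Qed.

Variable mu : {finite_measure set (borel X) -> \bar R}.
Variable nu : {finite_measure set (borel Y) -> \bar R}.
Hypothesis mu_box : box_counting_measure mu.
Hypothesis nu_box : box_counting_measure nu.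
Hypothesis X_doubling : doubling_space X.

(* Otherwise [d `^ (box_dim X - box_dim Y)] would tend to 0 with [d], whereas the
   packing estimates bound it away from 0. *)
Lemma box_dim_le : box_dim X <= box_dim Y.
Proof.
have L20 : 0 < 2 * L by rewrite mulr_gt0.
have [a a0 aP] := packing_number_ge_powR X_compact mu_box X_doubling.
have [b b0 /(near_scale L20) bP] := packing_number_le_powR Y_compact nu_box.
rewrite leNgt; apply/negP => ltXY.
pose p := box_dim X - box_dim Y.
have p0 : 0 < p by rewrite subr_gt0.
pose e := a / (b * (2 * L) `^ box_dim Y).
have e0 : 0 < e by rewrite divr_gt0// mulr_gt0// powR_gt0.
have d_gt0 : \forall d \near (0 : R)^'+, 0 < d by exact: nbhs_right_gt.
have dP := near_powR_lt p0 e0.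
suff : \forall d \near (0 : R)^'+, False by move=> /filter_ex[].
near=> d; have d0 : 0 < d by near: d.
have d'0 : 0 < d / (2 * L) by rewrite divr_gt0.
have : d `^ p < e by near: d.
have : a <= packing_number d [set: X] * d `^ box_dim X by near: d.
have : packing_number (d / (2 * L)) [set: Y] * (d / (2 * L)) `^ box_dim Y <= b.
  by near: d.
have : packing_number d [set: X] <= packing_number (d / (2 * L)) [set: Y].
  rewrite (le_trans (packing_number_image [set: X] d0))//.
  exact: packing_number_subset.
set N := packing_number _ _; set N' := packing_number _ _ => NN' N'b Na.
rewrite /e ltr_pdivlMr ?mulr_gt0 ?powR_gt0// => dab.
suff : a <= d `^ p * (b * (2 * L) `^ box_dim Y) by rewrite leNgt dab.
apply: (le_trans Na); apply: (@le_trans _ _ (N' * d `^ box_dim X)).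
  by rewrite ler_wpM2r ?powR_ge0.
have -> : d `^ box_dim X =
    d `^ p * ((d / (2 * L)) `^ box_dim Y * (2 * L) `^ box_dim Y).
  rewrite -powRM ?(ltW d'0) ?(ltW L20)// divfK ?gt_eqF//.
  by rewrite -powRD ?subrK// (gt_eqF d0) implybT.
by rewrite mulrCA ler_wpM2l ?powR_ge0// mulrA ler_wpM2r ?powR_ge0.
Unshelve. all: by end_near. Qed.

Hypothesis same_dim : box_dim X = box_dim Y.

(** At one sufficiently small [d], bound [mu K] by packings of a thickening of [K], carry these to
    [Y] at scale [d / (2 * L)], and bound them by [nu]. The factor [k] compensates for the change of
    scale. *)
Lemma closed_measure_le_image : exists2 c : R, 0 < c &
  forall K : set X, closed K -> (mu K <= c%:E * nu (f @` K))%E.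
Proof.
have L20 : 0 < 2 * L by rewrite mulr_gt0.
have [a a0 aP] := measure_le_packing X_compact mu_box X_doubling.
have [b b0 bP] := packing_le_measure Y_compact nu_box.
pose k := (2 * L) `^ box_dim Y.
have k0 : 0 < k by rewrite powR_gt0.
exists (a * k * b); first by rewrite !mulr_gt0.
move=> K clK.
(* Each of the two estimates costs a thickening, and each contributes [L * r] in [Y]. *)
have Kr r : 0 < r -> (mu K <= (a * k * b)%:E * nu (thickening (f @` K) (2 * L * r)))%E.
  move=> r0; have Lr0 : 0 < L * r by rewrite mulr_gt0.
  have aPr := aP K r r0 (borel_closed clK).
  have := bP (thickening (f @` K) (L * r)) (L * r) Lr0.
  move=> /(near_scale L20) bPr.
  have d_gt0 : \forall d \near (0 : R)^'+, 0 < d by exact: nbhs_right_gt.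
  near (0 : R)^'+ => d; have d0 : 0 < d by near: d.
  have d'0 : 0 < d / (2 * L) by rewrite divr_gt0.
  have /le_trans : (mu K <= (a * (packing_number d (thickening K r) *
      d `^ box_dim X))%:E)%E by near: d.
  apply.
  rewrite same_dim.
  have -> : d `^ box_dim Y = (d / (2 * L)) `^ box_dim Y * k.
    by rewrite -powRM ?(ltW d'0) ?(ltW L20)// divfK ?gt_eqF//.
  have : packing_number d (thickening K r) <=
      packing_number (d / (2 * L)) (thickening (f @` K) (L * r)).
    apply: (le_trans (packing_number_image _ d0)).
    by apply: packing_number_subset => //; exact: thickening_image.
  have bPd : ((packing_number (d / (2 * L)) (thickening (f @` K) (L * r)) *
      (d / (2 * L)) `^ box_dim Y)%:E <=
      b%:E * nu (thickening (thickening (f @` K) (L * r)) (L * r)))%E by near: d.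
  move: bPd; set N := packing_number d _; set N' := packing_number _ _ => bPd NN'.
  apply: (@le_trans _ _ (a * k * (N' * (d / (2 * L)) `^ box_dim Y))%:E).
    rewrite lee_fin -mulrA ler_pM2l// [leRHS]mulrC -mulrA.
    by rewrite ler_wpM2r ?mulr_ge0 ?powR_ge0// ltW.
  rewrite EFinM [in leRHS]EFinM -muleA lee_pmul2l ?lte_fin ?mulr_gt0//.
  apply: (le_trans bPd).
  rewrite lee_pmul2l ?lte_fin//; apply: le_measure; rewrite ?inE.
  - by apply: borel_open; exact: open_thickening.
  - by apply: borel_open; exact: open_thickening.
  - have -> : 2 * L * r = L * r + L * r by lra.
    exact: thickeningD.
rewrite leNgt; apply/negP.
rewrite -lte_pdivlMl ?mulr_gt0// => /(thickening_measure_lt (closed_image clK)).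
move=> [r r0]; have := Kr (r / (2 * L)) (divr_gt0 r0 L20).
by rewrite [2 * L * _]mulrC divfK ?gt_eqF// -lee_pdivrMl ?mulr_gt0// ltNge => ->.
Unshelve. all: by end_near. Qed.

(** Approximate [A] from inside by a closed [K]; the open [U] bounds what is lost, since [A] lies in
    the union of [K] and [U \ K]. *)
Lemma measure_le_image : exists2 c : R, 0 < c &
  forall A : set X, measurable (A : set (borel X)) ->
    (mu A <= c%:E * nu (f @` A))%E.
Proof.
have [c c0 cP] := closed_measure_le_image; exists c => // A mA.
apply/lee_addgt0Pr => e e0.
have [K [U [clK oU KA AU UKe]]] := borel_regular mu mA e0.
have mK := borel_closed clK; have mU := borel_open oU.
apply: (@le_trans _ _ (mu K + mu (U `\` K))%E).
  apply: (@le_trans _ _ (mu (K `|` (U `\` K)))).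
    apply: le_measure; rewrite ?inE//; last by rewrite setDUK// => x /KA/AU.
    by apply: measurableU => //; exact: measurableD.
  by apply: measureU2 => //; exact: measurableD.
apply: leeD; last exact: ltW.
apply: (le_trans (cP K clK)); rewrite lee_pmul2l ?lte_fin//.
by apply: le_measure; rewrite ?inE; [exact: borel_image..|exact: image_subset].
Qed.

End BiLipschitz.

(** * Spectra and Hausdorff dimension *)

Section LogRatio.
Context {R : realType}.
Implicit Types (m n : R -> R) (k b alpha : R).

Lemma inv_ln_cvg0 : (ln r)^-1 @[r --> (0 : R)^'+] --> (0 : R).
Proof.
apply/(ltr0_cvgV0 (f := @ln R)); last exact: lnNy.
apply/near_right0P; exists 1 => // r /andP[r0 r1].
by rewrite ln_lt0// r0.
Qed.

(** Scaling the radius multiplies the ratio by [1 + ln k / ln r], which tends to 1, and a constant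
    factor on the measure adds [b / ln r], which tends to 0. *)
Lemma cvg_log_ratio_scale m k b alpha : 0 < k ->
  ln (m r) / ln r @[r --> 0^'+] --> alpha ->
  (ln (m (k * r)) + b) / ln r @[r --> 0^'+] --> alpha.
Proof.
move=> k0 malpha.
have mk : ln (m (k * r)) / ln (k * r) @[r --> 0^'+] --> alpha.
  move=> P /malpha /near_scale -/(_ k^-1); rewrite invr_gt0 => /(_ k0).
  by apply: filterS => r; rewrite invrK mulrC.
have H : ln (m (k * r)) / ln (k * r) * (1 + ln k * (ln r)^-1) + b * (ln r)^-1
    @[r --> 0^'+] --> alpha * (1 + ln k * 0) + b * 0.
  apply: cvgD; last by apply: cvgMr; exact: inv_ln_cvg0.
  apply: cvgM => //; apply: cvgD; first exact: cvg_cst.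
  by apply: cvgMr; exact: inv_ln_cvg0.
move: H; rewrite !mulr0 !addr0 mulr1; apply: cvg_trans; apply: near_eq_cvg.
(* Below this threshold both [r] and [k * r] are less than 1, so both logarithms are nonzero. *)
apply/near_right0P; exists (Num.min 1 k^-1); first by rewrite lt_min ltr01 invr_gt0.
move=> r /andP[r0]; rewrite lt_min -[k^-1]mulr1 ltr_pdivlMl// => /andP[r1 kr1].
have lnr : ln r != 0 by rewrite lt_eqF// ln_lt0// r0.
have lnkr : ln (k * r) != 0 by rewrite lt_eqF// ln_lt0// mulr_gt0.
rewrite [RHS]mulrDl; congr (_ + _).
move: lnkr; rewrite lnM// => lnkr; field; exact/andP.
Qed.

(** A squeeze between two rescaled ratios of [m]. As [ln r] is negative, the upper bound on [n]
    yields the lower bound on its ratio, and conversely. *)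
Lemma log_ratio_cvg_comparable m n c c' k k' alpha :
  0 < c -> 0 < c' -> 0 < k -> 0 < k' ->
  (forall r, 0 < r -> 0 < m r) -> (forall r, 0 < r -> 0 < n r) ->
  (forall r, 0 < r -> m (k * r) <= c * n r) ->
  (forall r, 0 < r -> n r <= c' * m (k' * r)) ->
  ln (m r) / ln r @[r --> 0^'+] --> alpha ->
  ln (n r) / ln r @[r --> 0^'+] --> alpha.
Proof.
move=> c0 c'0 k0 k'0 m0 n0 mn nm malpha.
have mu := cvg_log_ratio_scale (- ln c) k0 malpha.
have ml := cvg_log_ratio_scale (ln c') k'0 malpha.
apply: squeeze_cvgr ml mu.
apply/near_right0P; exists 1 => // r /andP[r0 r1].
have lnr : (ln r)^-1 < 0 by rewrite invr_lt0 ln_lt0// r0.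
have mk : 0 < m (k * r) by apply: m0; rewrite mulr_gt0.
have mk' : 0 < m (k' * r) by apply: m0; rewrite mulr_gt0.
rewrite !ler_nM2r//; apply/andP; split.
  by rewrite -lnM ?posrE// mulrC ler_ln ?posrE ?n0 ?mulr_gt0// nm.
by rewrite lerBlDl -lnM ?posrE ?n0// ler_ln ?posrE ?mulr_gt0 ?n0// mn.
Qed.

End LogRatio.

Section LevelSets.
Context {R : realType} {X : pointedMetricType R}.
Variable mu : {finite_measure set (borel X) -> \bar R}.
Hypothesis mu_gt0 : forall (x : X) (r : R), 0 < r -> (0 < mu (ball x r))%E.

(** For [r < 1] the measure of the ball is finite and positive and [ln r] is nonzero, so the
    extended quotient is a real one. *)
Lemma level_setP alpha (x : X) : level_set mu alpha x <->
  ln (fine (mu (ball x r))) / ln r @[r --> 0^'+] --> alpha.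
Proof.
have E : {near 0^'+, (fun r : R => lne (mu (ball x r)) / (ln r)%:E)%E =1
    (fun r => (ln (fine (mu (ball x r))) / ln r)%:E)}.
  apply/near_right0P; exists 1 => // r /andP[r0 r1].
  have lnr : ln r != 0 by rewrite lt_eqF// ln_lt0// r0.
  have muE : mu (ball x r) = (fine (mu (ball x r)))%:E.
    by rewrite fineK// fin_num_measure//; apply: borel_open; exact: open_mball.
  have m0 : 0 < fine (mu (ball x r)) by rewrite -lte_fin -muE mu_gt0.
  by rewrite {1}muE lne_EFin// inver (negbTE lnr) EFinM.
split=> [xa|xa].
  have : (ln (fine (mu (ball x r))) / ln r)%:E @[r --> 0^'+] --> alpha%:E.
    exact: cvg_trans (near_eq_cvg E) xa.
  by move=> /fine_cvgP[].
apply: (@cvg_trans _ ((ln (fine (mu (ball x r))) / ln r)%:E @[r --> 0^'+])).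
  by apply: near_eq_cvg; apply: filterS E => r ->.
apply/fine_cvgP; split => //.
by near=> r.
Unshelve. all: by end_near. Qed.

End LevelSets.

(** * Hausdorff dimension under Lipschitz maps *)

Section Hausdorff.
Context {R : realType} {X Y : metricType R}.
Variables (f : X -> Y) (L : R).
Hypothesis L0 : 0 < L.
Hypothesis f_lip : forall x x', mdist (f x) (f x') <= L * mdist x x'.
Implicit Types (s d : R) (A U : set X).
Local Open Scope ereal_scope.

Lemma diam_ge0 {Z : metricType R} (A : set Z) : 0 <= diam A.
Proof. by rewrite /diam le_max lexx. Qed.

Lemma diam_image_le U : diam (f @` U) <= L%:E * diam U.
Proof.
rewrite {1}/diam ge_max mule_ge0 ?diam_ge0 ?lee_fin ?(ltW L0)//=.
apply: ge_ereal_sup => _ [_ [x Ux <-] [_ [x' Ux' <-] <-]].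
apply: (@le_trans _ _ (L * mdist x x')%:E); first by rewrite lee_fin.
by rewrite EFinM lee_pmul2l ?lte_fin// mdist_le_diam.
Qed.

Lemma hausdorff_gauge_image_le s U : (0 <= s)%R ->
  hausdorff_gauge s (f @` U) <= (L `^ s)%:E * hausdorff_gauge s U.
Proof.
move=> s0; rewrite /hausdorff_gauge; case: ifPn => [_|fU].
  by case: ifPn => _; rewrite ?mule0// mule_ge0 ?poweR_ge0// lee_fin powR_ge0.
rewrite ifF; last first.
  by apply: contraNF fU => /eqP ->; rewrite image_set0.
rewrite -poweR_EFin -poweRM ?diam_ge0 ?lee_fin ?(ltW L0)//.
apply: gt0_ler_poweR; rewrite ?diam_image_le// in_itv/= leey andbT.
  exact: diam_ge0.
by rewrite mule_ge0 ?diam_ge0// lee_fin ltW.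
Qed.

Lemma hausdorff_gauge_ge0 {Z : metricType R} s (U : set Z) :
  0 <= hausdorff_gauge s U.
Proof. by rewrite /hausdorff_gauge; case: ifP => // _; exact: poweR_ge0. Qed.

Lemma hausdorff_content_ge0 {Z : metricType R} s d (A : set Z) :
  0 <= hausdorff_content s d A.
Proof.
apply: le_ereal_inf_tmp => _ [U _ <-].
by apply: nneseries_ge0 => n _ _; exact: hausdorff_gauge_ge0.
Qed.

(** The dimension depends only on the exponents at which the measure vanishes, so preserving null
    sets is enough. *)
Lemma hausdorff_measure_image0 s A : (0 <= s)%R ->
  hausdorff_measure s A = 0 -> hausdorff_measure s (f @` A) = 0.
Proof.
move=> s0 HA; apply/eqP; rewrite eq_le; apply/andP; split; last first.
  apply: (@le_trans _ _ (hausdorff_content s 1 (f @` A))).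
    exact: hausdorff_content_ge0.
  by apply: ereal_sup_ubound; exists 1%R => /=.
apply: ge_ereal_sup => _ [d /= d0 <-]; apply/lee_addgt0Pr => e e0; rewrite add0e.
have dL0 : (0 < d / L)%R by rewrite divr_gt0.
have : hausdorff_content s (d / L) A < (e / L `^ s)%:E.
  apply: (@le_lt_trans _ _ 0); last by rewrite lte_fin divr_gt0// powR_gt0.
  by rewrite -HA; apply: ereal_sup_ubound; exists (d / L)%R.
move=> /ereal_inf_lt[_ [U [AU Ud] <-] Ue].
apply: (@le_trans _ _ (\sum_(0 <= i <oo) hausdorff_gauge s (f @` U i))).
  apply: ereal_inf_lbound; exists (fun i => f @` U i) => //; split.
    by move=> _ [x /AU[i _ Ux] <-]; exists i => //; exists x.
  move=> i; apply: (le_trans (diam_image_le _)).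
  by rewrite -lee_pdivlMl// (le_trans (Ud i))// -EFinM lee_fin mulrC.
apply: (@le_trans _ _ (\sum_(0 <= i <oo) ((L `^ s)%:E * hausdorff_gauge s (U i)))).
  apply: lee_nneseries => [i _ _|i _]; first exact: hausdorff_gauge_ge0.
  exact: hausdorff_gauge_image_le.
rewrite nneseriesZl; last by move=> i _; exact: hausdorff_gauge_ge0.
by rewrite -lee_pdivlMl ?powR_gt0// (le_trans (ltW Ue))// -EFinM lee_fin mulrC.
Qed.

End Hausdorff.

Lemma hausdorff_dim_image {R : realType} {X Y : metricType R} (f : X -> Y)
    (g : Y -> X) (L : R) : 0 < L -> cancel f g ->
  (forall x x', mdist (f x) (f x') <= L * mdist x x') ->
  (forall y y', mdist (g y) (g y') <= L * mdist y y') ->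
  forall A, hausdorff_dim (f @` A) = hausdorff_dim A.
Proof.
move=> L0 fK f_lip g_lip A; rewrite /hausdorff_dim; congr (ereal_inf (image _ _)).
apply/seteqP; split=> s [s0 sA]; split => //.
  have -> : A = g @` (f @` A).
    by rewrite image_comp (_ : g \o f = id) ?image_id//; exact/funext.
  exact: (hausdorff_measure_image0 L0 g_lip s0 sA).
exact: (hausdorff_measure_image0 L0 f_lip s0 sA).
Qed.

(** * Transfer of level sets and doubling between comparable measures *)

Section ComparableMeasures.
Context {R : realType} {X Y : pointedMetricType R}.
Variables (f : X -> Y) (g : Y -> X) (L : R).
Hypothesis L0 : 0 < L.
Hypotheses (fK : cancel f g) (gK : cancel g f).
Hypothesis f_lip : forall x x', mdist (f x) (f x') <= L * mdist x x'.
Hypothesis g_lip : forall y y', mdist (g y) (g y') <= L * mdist y y'.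
Variable mu : {finite_measure set (borel X) -> \bar R}.
Variable nu : {finite_measure set (borel Y) -> \bar R}.
Variables (c c' : R).
Hypotheses (c0 : 0 < c) (c'0 : 0 < c').
Hypothesis mu_le : forall A : set X, measurable (A : set (borel X)) ->
  (mu A <= c%:E * nu (f @` A))%E.
Hypothesis nu_le : forall B : set Y, measurable (B : set (borel Y)) ->
  (nu B <= c'%:E * mu (g @` B))%E.
Hypothesis mu_gt0 : forall (x : X) (r : R), 0 < r -> (0 < mu (ball x r))%E.
Hypothesis nu_gt0 : forall (y : Y) (r : R), 0 < r -> (0 < nu (ball y r))%E.

Let measurable_ball (Z : pointedMetricType R) (z : Z) (r : R) :
  measurable (ball z r : set (borel Z)).
Proof. by apply: borel_open; exact: open_mball. Qed.

Lemma ball_image_sub (x : X) (r : R) : f @` ball x (L^-1 * r) `<=` ball (f x) r.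
Proof.
move=> _ [x' + <-]; rewrite !ball_mdist => xx'.
by rewrite (le_lt_trans (f_lip _ _))// -ltr_pdivlMl.
Qed.

Lemma ball_image_inverse_sub (y : Y) (r : R) : g @` ball y r `<=` ball (g y) (L * r).
Proof.
move=> _ [y' + <-]; rewrite !ball_mdist => yy'.
by rewrite (le_lt_trans (g_lip _ _))// ltr_pM2l.
Qed.

Lemma measure_ball_le (x : X) (r : R) :
  (mu (ball x (L^-1 * r)) <= c%:E * nu (ball (f x) r))%E.
Proof.
apply: (le_trans (mu_le (measurable_ball _ _))); rewrite lee_pmul2l ?lte_fin//.
apply: le_measure; rewrite ?inE//; last exact: ball_image_sub.
exact: (borel_image L0 fK gK g_lip).
Qed.

Lemma measure_ball_le_inverse (y : Y) (r : R) :
  (nu (ball y r) <= c'%:E * mu (ball (g y) (L * r)))%E.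
Proof.
apply: (le_trans (nu_le (measurable_ball _ _))); rewrite lee_pmul2l ?lte_fin//.
apply: le_measure; rewrite ?inE//; last exact: ball_image_inverse_sub.
exact: (borel_image L0 gK fK f_lip).
Qed.

Lemma level_set_image_sub alpha : f @` level_set mu alpha `<=` level_set nu alpha.
Proof.
move=> _ [x /(level_setP mu_gt0) xa <-]; apply/(level_setP nu_gt0).
have fine0 (Z : pointedMetricType R)
    (m : {finite_measure set (borel Z) -> \bar R}) (z : Z) :
    (forall r, 0 < r -> (0 < m (ball z r))%E) ->
    (forall r, 0 < r -> 0 < fine (m (ball z r))).
  move=> m0 r r0; rewrite fine_gt0// m0//= -ge0_fin_numE//.
  by apply: fin_num_measure; exact: measurable_ball.
have L'0 : 0 < L^-1 by rewrite invr_gt0.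
apply: (log_ratio_cvg_comparable c0 c'0 L'0 L0 _ _ _ _ xa).
- exact: fine0 (mu_gt0 x).
- exact: fine0 (nu_gt0 (f x)).
- move=> r r0; rewrite -lee_fin EFinM !fineK ?fin_num_measure//.
  exact: measure_ball_le.
- move=> r r0; rewrite -lee_fin EFinM !fineK ?fin_num_measure//.
  by have := measure_ball_le_inverse (f x) r; rewrite fK.
Qed.

(** Pass from [nu] on the ball of radius [2 * r] to [mu] at radius [L * (2 * r)], shrink to radius
    [L^-1 * r] by iterated doubling, and return to [nu] at radius [r]. *)
Lemma doubling_measure_image : doubling_measure mu -> doubling_measure nu.
Proof.
move=> [C [C0 CP]].
have iter n x (r : R) : 0 < r ->
    (mu (ball x (2 ^+ n * r)) <= (C ^+ n)%:E * mu (ball x r))%E.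
  move=> r0; elim: n => [|n IHn]; first by rewrite !expr0 mul1r mul1e.
  rewrite exprS -mulrA (le_trans (CP x _ _).2)// ?mulr_gt0 ?exprn_gt0//.
  by rewrite exprS EFinM -muleA lee_pmul2l ?lte_fin.
(* The ratio of the radii [L * (2 * r)] and [L^-1 * r] is [L * 2 * L], so [n] doublings are
   enough. *)
have [n Ln] : exists n, L * 2 * L <= 2 ^+ n :> R.
  exists (Num.truncn (L * 2 * L)).+1.
  by rewrite (le_trans (ltW (truncnS_gt _)))// -natrX ler_nat ltnW// ltn_expl.
exists (c' * C ^+ n * c); split; first by rewrite !mulr_gt0// exprn_gt0.
move=> y r r0; split; first by rewrite nu_gt0// mulr_gt0.
apply: (le_trans (measure_ball_le_inverse y _)).
rewrite -mulrA EFinM -muleA lee_pmul2l ?lte_fin//.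
have r'0 : 0 < L^-1 * r by rewrite mulr_gt0// invr_gt0.
apply: (@le_trans _ _ (mu (ball (g y) (2 ^+ n * (L^-1 * r))))).
  apply: le_measure; rewrite ?inE//; apply: le_ball.
  rewrite mulrA [leRHS]mulrA ler_pM2r// ler_pdivlMr//; exact: Ln.
apply: (le_trans (iter n _ _ r'0)).
rewrite EFinM -muleA lee_pmul2l ?lte_fin ?exprn_gt0//.
by have := measure_ball_le (g y) r; rewrite gK.
Qed.

End ComparableMeasures.

Theorem corollary1p8 (R : realType) (X Y : pointedMetricType R)
    (X_compact : compact [set: X]) (Y_compact : compact [set: Y])
    (X_doubling : doubling_space X) (Y_doubling : doubling_space Y)
    (mu : {finite_measure set (borel X) -> \bar R})
    (nu : {finite_measure set (borel Y) -> \bar R})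
    (mu_box : box_counting_measure mu) (nu_box : box_counting_measure nu)
    (f : X -> Y) (f_bilip : bi_lipschitz f) :
  [/\ measure_equiv (pushforward mu (f : borel X -> borel Y)) nu,
      forall alpha : R, 0 <= alpha ->
        multifractal_spectrum mu alpha = multifractal_spectrum nu alpha
    & doubling_measure mu <-> doubling_measure nu].
Proof.
have [[g fK gK] [L [L0 fL]]] := f_bilip.
have f_lip x x' : mdist (f x) (f x') <= L * mdist x x'.
  by have /andP[] := fL x x'.
have g_lip y y' : mdist (g y) (g y') <= L * mdist y y'.
  by have /andP[+ _] := fL (g y) (g y'); rewrite !gK ler_pdivrMl.
have same_dim : box_dim X = box_dim Y.
  apply/eqP; rewrite eq_le (box_dim_le _ _ L0 fK g_lip mu_box nu_box)//.
  by rewrite (box_dim_le _ _ L0 gK f_lip nu_box mu_box).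
have [c c0 mu_le] := measure_le_image X_compact Y_compact L0 fK gK f_lip g_lip
  mu_box nu_box X_doubling same_dim.
have [c' c'0 nu_le] := measure_le_image Y_compact X_compact L0 gK fK g_lip f_lip
  nu_box mu_box Y_doubling (esym same_dim).
have mu_gt0 := box_counting_gt0 X_compact mu_box.
have nu_gt0 := box_counting_gt0 Y_compact nu_box.
split=> [|alpha _|].
(* The sum dominates both constants, so it serves for both inequalities. *)
- exists (c + c'); split=> [|A mA]; first by rewrite addr_gt0.
  have fA : f @^-1` A = g @` A by rewrite (image_preimage_inverse gK fK).
  rewrite /pushforward -lee_pdivlMl ?invr_gt0 ?addr_gt0// invrK fA; split.
    have mgA : measurable (g @` A : set (borel X)).
      exact: (borel_image L0 gK fK f_lip).
    apply: (le_trans (mu_le _ mgA)).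
    rewrite image_comp (_ : f \o g = id) ?image_id; last exact/funext.
    by rewrite lee_wpmul2r// lee_fin lerDl ltW.
  by rewrite (le_trans (nu_le _ mA))// lee_wpmul2r// lee_fin lerDr ltW.
- rewrite /multifractal_spectrum -(hausdorff_dim_image L0 fK f_lip g_lip).
  congr hausdorff_dim; apply/seteqP; split.
    exact: (level_set_image_sub L0 fK gK f_lip g_lip c0 c'0 mu_le nu_le
      mu_gt0 nu_gt0).
  (* The reverse inclusion asks that [g y] be in the level set of [mu]; this is the first inclusion
     with the two spaces exchanged. *)
  rewrite (image_preimage_inverse fK gK) => y ya.
  apply: (level_set_image_sub L0 gK fK g_lip f_lip c'0 c0 nu_le mu_le
    nu_gt0 mu_gt0).
  by exists y.
- split.
  + exact: (doubling_measure_image L0 fK gK f_lip g_lip c0 c'0 mu_le nu_le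
      nu_gt0).
  + exact: (doubling_measure_image L0 gK fK g_lip f_lip c'0 c0 nu_le mu_le
      mu_gt0).
Qed.
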